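(* If the arrival rates of all information sources are the same, i.e. $p_i=p_j$ for all $i\neq j$, then the index scheduling algorithm is age-optimal.
   Context: Network model. There are $N\ge 1$ users, with arrival probabilities $p_1,\dots,p_N>0$. Time is slotted, $t=0,1,2,\dots$. Arrival indicators $\Lambda_i(t)\in\{0,1\}$ are independent across users and slots, with $P[\Lambda_i(t)=1]=p_i$. In each slot $t$, after observing the ages $X_i(t)$ and arrivals $\Lambda_i(t)$, a decision $D(t)\in\{0,1,\dots,N\}$ is made ($0$: no transmission; $i$: user $i$ is scheduled). The ages evolve by $X_i(t+1)=1$ if $\Lambda_i(t)=1$ and $D(t)=i$, and $X_i(t+1)=X_i(t)+1$ otherwise. The initial age vector $(X_1(0),\dots,X_N(0))$ consists of pairwise distinct integers $\geq1$. A scheduling algorithm $\pi=\{D(0),D(1),\dots\}$ specifies a decision for each slot, possibly at random and depending on the past decisions and on the ages and arrivals up to and including the current slot. Its average age is $\limsup_{T\to\infty}\frac{1}{T+1}E_\pi\left[\sum_{t=0}^T\sum_{i=1}^N X_i(t)\right]$. A scheduling algorithm is age-optimal if it minimizes the average age over all scheduling algorithms. Index scheduling algorithm: in each slot $t$, $D(t)=\arg\max_{i=1,\dots,N}I_i(X_i(t),\Lambda_i(t))$, where $I_i(x,0)=0$ and $I_i(x,1)=\frac{x^2}{2}-\frac{x}{2}+\frac{x}{p_i}$. *)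

(* Defs.v *)
From HB Require Import structures.
From mathcomp Require Import all_boot all_order all_algebra.
From mathcomp Require Import all_classical all_reals all_analysis.

Set Implicit Arguments.
Unset Strict Implicit.
Unset Printing Implicit Defensive.

Import Order.TTheory GRing.Theory Num.Theory.
Local Open Scope ring_scope.

Definition arrivals (N : nat) := {ffun 'I_N -> bool}.

(* [None] means that no user transmits, [Some i] that user i is scheduled. *)
Definition decision (N : nat) := option 'I_N.

Definition slot (N : nat) := (arrivals N * decision N)%type.

Definition ages (N : nat) := {ffun 'I_N -> nat}.

Definition next_ages (N : nat) (x : ages N) (s : slot N) : ages N :=
  [ffun i => if s.1 i && (s.2 == Some i) then 1%N else (x i).+1].

(* The ages X(t) at the beginning of slot t, where t = size h and h lists the
   arrivals and decisions of the slots 0, ..., t - 1. *)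
Definition ages_after (N : nat) (x0 : ages N) (h : seq (slot N)) : ages N :=
  foldl (@next_ages N) x0 h.

(* [decide h a d] is the conditional probability of the decision d in slot
   t = size h, given the arrivals and decisions h of the slots 0, ..., t - 1 and
   the arrivals a of slot t.  The ages X(0), ..., X(t) are not a separate
   argument because h and the fixed initial ages determine them. *)
Record algorithm (R : realType) (N : nat) := Algorithm {
  decide :> seq (slot N) -> arrivals N -> decision N -> R;
  decide_ge0 : forall h a d, 0 <= decide h a d;
  decide_sum1 : forall h a, \sum_d decide h a d = 1
}.

Section Model.
Variables (R : realType) (N : nat) (p : 'I_N -> R) (x0 : ages N).
Implicit Types (pi : algorithm R N) (h : seq (slot N)) (a : arrivals N).

Definition arrivals_prob a : R := \prod_i (if a i then p i else 1 - p i).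

Definition slot_prob pi h (s : slot N) : R :=
  arrivals_prob s.1 * pi h s.1 s.2.

(* The probability under pi that w is the sequence of arrivals and decisions of
   the slots 0, ..., n - 1. *)
Definition law pi (n : nat) (w : n.-tuple (slot N)) : R :=
  \prod_(t < n) slot_prob pi (take t w) (tnth w t).

(* E_pi of a random variable that depends on the slots 0, ..., n - 1 only. *)
Definition expect pi (n : nat) (f : n.-tuple (slot N) -> R) : R :=
  \sum_w law pi w * f w.

Definition total_age (T : nat) (w : T.+1.-tuple (slot N)) : R :=
  \sum_(t < T.+1) \sum_i (ages_after x0 (take t w) i)%:R.

Definition average_age pi : \bar R :=
  limn_esup (fun T => ((T.+1%:R)^-1 * expect pi (@total_age T))%:E).

Definition age_optimal pi : Prop :=
  forall pi', (average_age pi <= average_age pi')%E.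

Definition user_index (i : 'I_N) (x : nat) (b : bool) : R :=
  if b then x%:R ^+ 2 / 2 - x%:R / 2 + x%:R / p i else 0.

(* Ties of the argmax may be broken arbitrarily, possibly at random. *)
Definition index_algorithm pi : Prop :=
  forall h a d, 0 < pi h a d ->
    exists2 i, d = Some i &
      forall j, user_index j (ages_after x0 h j) (a j)
                <= user_index i (ages_after x0 h i) (a i).

Lemma arrivals_prob_sum1 : \sum_a arrivals_prob a = 1.
Proof.
rewrite /arrivals_prob.
rewrite -(bigA_distr_bigA (fun i b => if b then p i else 1 - p i)).
by apply: big1 => i _; rewrite big_bool /= addrC subrK.
Qed.

Lemma slot_prob_sum1 pi h : \sum_s slot_prob pi h s = 1.
Proof.
rewrite -(pair_bigA _ (fun a d => slot_prob pi h (a, d))) /slot_prob /=.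
under eq_bigr do rewrite -mulr_sumr decide_sum1 mulr1.
exact: arrivals_prob_sum1.
Qed.

Lemma law_rcons pi n (w : n.-tuple (slot N)) s :
  law pi [tuple of rcons w s] = law pi w * slot_prob pi w s.
Proof.
rewrite /law big_ord_recr /=; congr (_ * _).
  apply: eq_bigr => t _; congr (slot_prob _ _ _).
    by rewrite -cats1 takel_cat ?size_tuple 1?ltnW.
  by rewrite !(tnth_nth s) /= nth_rcons size_tuple ltn_ord.
congr (slot_prob _ _ _).
  by rewrite -cats1 takel_cat ?size_tuple // take_oversize ?size_tuple.
by rewrite (tnth_nth s) /= nth_rcons size_tuple ltnn eqxx.
Qed.

Lemma sum_tuple0 (F : 0.-tuple (slot N) -> R) : \sum_w F w = F [tuple].
Proof.
rewrite (bigD1 [tuple]) //= big1 ?addr0 // => w.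
by rewrite (tuple0 w) => /eqP.
Qed.

Lemma sum_rcons n (F : n.+1.-tuple (slot N) -> R) :
  \sum_w F w = \sum_(w : n.-tuple (slot N)) \sum_s F [tuple of rcons w s].
Proof.
rewrite pair_bigA /=.
pose g (u : n.+1.-tuple (slot N)) : n.-tuple (slot N) * slot N :=
  ([tuple of belast (thead u) (behead u)], last (thead u) (behead u)).
rewrite (reindex (fun u : n.-tuple (slot N) * slot N =>
                    [tuple of rcons u.1 u.2])) //=.
exists g => [[w s] _|u _]; rewrite /g.
  have E : thead [tuple of rcons w s] :: behead (rcons w s) = rcons w s.
    by case: w => -[|y w] //= Hw; rewrite (tnth_nth s).
  have := E; rewrite lastI => /rcons_inj[E1 E2].
  by congr pair => //; apply: val_inj.
by apply: val_inj; rewrite /= -lastI {3}(tuple_eta u).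
Qed.

(* Sanity checks: the finite-horizon laws are consistent probability laws, the
   arrivals are independent Bernoulli variables whatever the algorithm, and
   index algorithms exist. *)
Lemma law_consistent pi n (w : n.-tuple (slot N)) :
  \sum_s law pi [tuple of rcons w s] = law pi w.
Proof.
by under eq_bigr do rewrite law_rcons; rewrite -mulr_sumr slot_prob_sum1 mulr1.
Qed.

Lemma law_sum1 pi n : \sum_(w : n.-tuple (slot N)) law pi w = 1.
Proof.
elim: n => [|n IHn]; last first.
  by rewrite sum_rcons -IHn; apply: eq_bigr => w _; exact: law_consistent.
by rewrite sum_tuple0 /law big_ord0.
Qed.

Lemma law_ge0 pi n (w : n.-tuple (slot N)) :
  (forall i, 0 <= p i <= 1) -> 0 <= law pi w.
Proof.
move=> p01; apply: prodr_ge0 => t _; apply: mulr_ge0; last exact: decide_ge0.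
apply: prodr_ge0 => i _; have /andP[p0 p1] := p01 i.
by case: ifP; rewrite ?subr_ge0.
Qed.

Lemma expect_arrivals pi n (f : nat -> arrivals N -> R) :
  expect pi (fun w : n.-tuple (slot N) => \prod_(t < n) f t (tnth w t).1)
  = \prod_(t < n) \sum_a arrivals_prob a * f t a.
Proof.
rewrite /expect; elim: n => [|n IHn].
  by rewrite sum_tuple0 /law !big_ord0 mulr1.
rewrite sum_rcons big_ord_recr /= -IHn mulr_suml; apply: eq_bigr => w _.
transitivity (\sum_a \sum_d law pi [tuple of rcons w (a, d)] *
    \prod_(t < n.+1) f t (tnth [tuple of rcons w (a, d)] t).1).
  by rewrite pair_bigA; apply: eq_bigr => -[].
rewrite mulr_sumr.
apply: eq_bigr => a _.
transitivity (\sum_d law pi w * (\prod_(t < n) f t (tnth w t).1) *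
    (arrivals_prob a * f n a) * pi w a d); last first.
  by rewrite -mulr_sumr decide_sum1 mulr1.
apply: eq_bigr => d _; rewrite law_rcons big_ord_recr /= /slot_prob /=.
rewrite [tnth _ ord_max](tnth_nth (a, d)) /= nth_rcons size_tuple ltnn eqxx /=.
rewrite (eq_bigr (fun t : 'I_n => f t (tnth w t).1)) => [|t _]; last first.
  by rewrite !(tnth_nth (a, d)) /= nth_rcons size_tuple ltn_ord.
rewrite -!mulrA; congr (_ * _); rewrite [RHS]mulrCA; congr (_ * _).
by rewrite mulrC mulrA.
Qed.

Lemma index_algorithm_exists :
  (0 < N)%N -> exists pi, index_algorithm pi.
Proof.
move=> N0; pose i0 := Ordinal N0.
pose c h a := [arg max_(i > i0) user_index i (ages_after x0 h i) (a i)]%O.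
have ge0 h a d : 0 <= (d == Some (c h a))%:R :> R by [].
have sum1 h a : \sum_d (d == Some (c h a))%:R = 1 :> R.
  rewrite (bigD1 (Some (c h a))) //= eqxx big1 ?addr0 // => d.
  by move=> /negPf ->.
exists (Algorithm ge0 sum1) => h a d /=; case: eqP => [-> _|_]; last by rewrite ltxx.
by exists (c h a) => // j; rewrite /c; case: arg_maxP => // i _; exact.
Qed.

End Model.

(* Main.v *)
Require Import Defs.
From mathcomp Require Import all_boot all_order all_algebra.
From mathcomp Require Import perm lra.
From mathcomp Require Import all_classical all_reals all_analysis.
Import Order.TTheory GRing.Theory Num.Theory.
Local Open Scope ring_scope.

Set Implicit Arguments.
Unset Strict Implicit.
Unset Printing Implicit Defensive.

(** With equal rates users are exchangeable, so an age vector matters only up to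
    a permutation of the users.  Scheduling the oldest user with an arrival leads
    to an age vector that is, after exchanging two users, pointwise below the one
    produced by any other decision; and the least expected total age reachable
    after n more slots (a Bellman recursion) is monotone for this order.  Hence
    the index algorithm, which is oldest-first here, minimizes the expected total
    age of every single slot, and a fortiori the limsup of the averages. *)

Lemma limn_esup_le_mono (R : realType) (u v : (\bar R)^nat) :
  (forall n, u n <= v n)%E -> (limn_esup u <= limn_esup v)%E.
Proof.
move=> uv; rewrite /limn_esup !limf_esupE.
apply: le_ereal_inf_tmp => _ [V FV <-]; apply: ge_ereal_inf.
exists (ereal_sup [set u x | x in V]%classic); first by exists V.
apply/ereal_supP => _ [n Vn <-]; apply: le_ereal_sup_tmp.
by exists (v n); [exists n|exact: uv].
Qed.

Definition dominated (N : nat) (x y : ages N) : Prop :=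
  exists s : {perm 'I_N}, forall i, (x i <= y (s i))%N.

(** If no user has an arrival, any [Some i] qualifies: the index algorithm then picks freely among
    zero indices. *)
Definition oldest_first (N : nat) (x : ages N) (a : arrivals N) (d : decision N) :=
  exists2 i, d = Some i & forall j, a j -> a i && (x j <= x i)%N.

Lemma ages_after_rcons N (x0 : ages N) h s :
  ages_after x0 (rcons h s) = next_ages (ages_after x0 h) s.
Proof. exact: foldl_rcons. Qed.

Lemma ages_after_gt0 N (x0 : ages N) h i :
  (forall j, 0 < x0 j)%N -> (0 < ages_after x0 h i)%N.
Proof.
move=> x0_gt0; case/lastP: h => [//|h s].
by rewrite ages_after_rcons ffunE; case: ifP.
Qed.

Lemma dominated_oldest_first N (x : ages N) a d d' :
  oldest_first x a d -> dominated (next_ages x (a, d)) (next_ages x (a, d')).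
Proof.
move=> [i -> old_i]; have [[j -> aj]|idle] : (exists2 j, d' = Some j & a j) \/
    (forall j, d' = Some j -> ~~ a j).
  case: d' => [j|]; last by right.
  by case: (boolP (a j)) => aj; [left; exists j|right => _ [<-]].
- have /andP[ai xji] := old_i _ aj.
  (* Exchanging [i] and [j] matches the two reset users and leaves [x j + 1] against [x i + 1]. *)
  exists (tperm i j) => k; rewrite !ffunE /= [Some i == _]eq_sym [Some j == _]eq_sym.
  rewrite !(inj_eq (@Some_inj _)).
  case: tpermP => [->|->|/eqP/negPf ki /eqP/negPf kj]; last first.
  + by rewrite ki kj !andbF.
  + by have [->|] := eqVneq j i; rewrite ?ai ?eqxx ?andbF.
  + by rewrite ai aj !eqxx.
- exists 1%g => k; rewrite !ffunE perm1 /=.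
  have -> : a k && (d' == Some k) = false.
    by apply/negP => /andP[ak /eqP /idle]; rewrite ak.
  by case: ifP.
Qed.

Section OptimalAge.
Variables (R : realType) (N : nat) (p : 'I_N -> R).
Hypothesis p_prob : forall i, 0 <= p i <= 1.

(** Only the age in the final slot counts, not an accumulated cost. The default of the minimum is
    the value of idling, itself one of the candidates. *)
Fixpoint optimal_age (n : nat) (x : ages N) : R :=
  if n is m.+1 then
    \sum_a arrivals_prob p a *
      \big[Num.min/optimal_age m (next_ages x (a, None))]_d
        optimal_age m (next_ages x (a, d))
  else \sum_i (x i)%:R.

Lemma arrivals_prob_ge0 a : 0 <= arrivals_prob p a.
Proof.
apply: prodr_ge0 => i _; have /andP[p0 p1] := p_prob i.
by case: ifP; rewrite ?subr_ge0.
Qed.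

Lemma arrivals_prob_perm (s : {perm 'I_N}) (a : arrivals N) :
  (forall i j, p i = p j) -> arrivals_prob p [ffun i => a (s i)] = arrivals_prob p a.
Proof.
move=> p_const; rewrite /arrivals_prob [RHS](reindex_perm s) /=.
by apply: eq_bigr => i _; rewrite ffunE (p_const (s i) i).
Qed.

(** A coupling argument: user [i] of [x] imitates user [s i] of [y], both in arrivals and in
    decisions. Equal rates make the relabelled arrivals equally likely. *)
Lemma optimal_age_dominated n x y : (forall i j, p i = p j) ->
  dominated x y -> optimal_age n x <= optimal_age n y.
Proof.
move=> p_const; elim: n x y => [|n IHn] x y [s xy] /=.
  by rewrite [leRHS](reindex_perm s) ler_sum // => i _; rewrite ler_nat.
pose f (a : arrivals N) : arrivals N := [ffun i => a (s i)].
have f_bij : bijective f.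
  exists (fun a : arrivals N => [ffun i => a ((s^-1)%g i)]) => a; apply/ffunP => i;
  by rewrite !ffunE ?permK ?permKV.
rewrite (reindex f) /=; last exact: onW_bij.
apply: ler_sum => a _; rewrite arrivals_prob_perm // ler_wpM2l ?arrivals_prob_ge0 //.
have next_dom d : dominated (next_ages x (f a, omap (s^-1)%g d)) (next_ages y (a, d)).
  exists s => i; rewrite !ffunE /=.
  suff -> : (omap (s^-1)%g d == Some i) = (d == Some (s i)) by case: ifP => // _; rewrite ltnS.
  case: d => [j|] //=; rewrite !(inj_eq (@Some_inj _)).
  by apply/eqP/eqP => [<-|->]; rewrite ?permK ?permKV.
apply: le_bigmin => [|d _].
  exact: le_trans (bigmin_le _ None _) (IHn _ _ (next_dom None)).
exact: le_trans (bigmin_le _ (omap (s^-1)%g d) _) (IHn _ _ (next_dom d)).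
Qed.

Variable x0 : ages N.
Implicit Type pi : algorithm R N.

Lemma expect_rcons pi n (f : n.+1.-tuple (slot N) -> R) :
  expect p pi f = \sum_(w : n.-tuple (slot N)) law p pi w *
    \sum_s slot_prob p pi w s * f [tuple of rcons w s].
Proof.
rewrite /expect sum_rcons; apply: eq_bigr => w _; rewrite mulr_sumr.
by apply: eq_bigr => s _; rewrite law_rcons mulrA.
Qed.

Lemma sum_slot_prob pi h (f : slot N -> R) :
  \sum_s slot_prob p pi h s * f s =
  \sum_a arrivals_prob p a * \sum_d pi h a d * f (a, d).
Proof.
under [RHS]eq_bigr do rewrite mulr_sumr.
by rewrite pair_bigA; apply: eq_bigr => -[a d] _; rewrite mulrA.
Qed.

(** An average over decisions is at least their minimum. *)
Lemma optimal_age_le_step pi m h :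
  optimal_age m.+1 (ages_after x0 h) <=
  \sum_s slot_prob p pi h s * optimal_age m (ages_after x0 (rcons h s)).
Proof.
rewrite sum_slot_prob; apply: ler_sum => a _.
rewrite ler_wpM2l ?arrivals_prob_ge0 //.
rewrite -[leLHS]mul1r -[X in X * _ <= _](decide_sum1 pi h a) mulr_suml ler_sum // => d _.
by rewrite ler_wpM2l ?decide_ge0 // ages_after_rcons bigmin_le.
Qed.

(** Every decision of positive probability attains the minimum, since its successor ages are
    dominated by those of any other decision. *)
Lemma optimal_age_eq_step pi m h : (forall i j, p i = p j) ->
  (forall a d, 0 < pi h a d -> oldest_first (ages_after x0 h) a d) ->
  optimal_age m.+1 (ages_after x0 h) =
  \sum_s slot_prob p pi h s * optimal_age m (ages_after x0 (rcons h s)).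
Proof.
move=> p_const old; apply/le_anti; rewrite optimal_age_le_step sum_slot_prob /=.
apply: ler_sum => a _; rewrite ler_wpM2l ?arrivals_prob_ge0 //.
rewrite -[leRHS]mul1r -[X in _ <= X * _](decide_sum1 pi h a) mulr_suml ler_sum // => d _.
have := decide_ge0 pi h a d; rewrite le0r => /predU1P[->|pid]; first by rewrite !mul0r.
rewrite ler_pM2l // ages_after_rcons.
by apply: le_bigmin => [|d' _]; apply: optimal_age_dominated => //;
  apply: dominated_oldest_first; apply: old.
Qed.

(** The induction trades one remaining slot for one elapsed slot, so [m] must vary. The case [m = 0]
    bounds the expected total age in slot [n] from below. *)
Lemma optimal_age_le_expect pi n m :
  optimal_age (n + m) x0 <=
  expect p pi (fun w : n.-tuple (slot N) => optimal_age m (ages_after x0 w)).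
Proof.
elim: n m => [|n IHn] m.
  by rewrite /expect sum_tuple0 /law big_ord0 mul1r.
rewrite addSnnS (le_trans (IHn _)) // expect_rcons ler_sum // => w _.
by rewrite ler_wpM2l ?law_ge0 // optimal_age_le_step.
Qed.

Lemma optimal_age_eq_expect pi n m : (forall i j, p i = p j) ->
  (forall h a d, 0 < pi h a d -> oldest_first (ages_after x0 h) a d) ->
  expect p pi (fun w : n.-tuple (slot N) => optimal_age m (ages_after x0 w)) =
  optimal_age (n + m) x0.
Proof.
move=> p_const old; elim: n m => [|n IHn] m.
  by rewrite /expect sum_tuple0 /law big_ord0 mul1r.
rewrite addSnnS -IHn expect_rcons; apply: eq_bigr => w _.
by rewrite -optimal_age_eq_step //; exact: old.
Qed.

(** Each summand depends on a prefix only, and the law of a later slot sums to 1. *)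
Lemma expect_sum_take pi n (f : seq (slot N) -> R) :
  expect p pi (fun w : n.-tuple (slot N) => \sum_(t < n) f (take t w)) =
  \sum_(t < n) expect p pi (fun w : t.-tuple (slot N) => f w).
Proof.
elim: n => [|n IHn]; first by rewrite /expect sum_tuple0 !big_ord0 mulr0.
rewrite expect_rcons big_ord_recr /= -IHn /expect -big_split /=.
apply: eq_bigr => w _; rewrite -mulrDr; congr (_ * _).
rewrite -[RHS]mul1r -[X in _ = X * _](slot_prob_sum1 p pi w) mulr_suml.
apply: eq_bigr => s _; rewrite big_ord_recr /=; congr (_ * (_ + f _)).
  apply: eq_bigr => t _; congr f.
  by rewrite -cats1 takel_cat ?size_tuple 1?ltnW.
by rewrite -cats1 takel_cat ?size_tuple // take_oversize ?size_tuple.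
Qed.

Lemma expect_total_age pi T :
  expect p pi (@total_age R N x0 T) =
  \sum_(t < T.+1) expect p pi
    (fun w : t.-tuple (slot N) => optimal_age 0 (ages_after x0 w)).
Proof. exact: (expect_sum_take _ _ (fun h => optimal_age 0 (ages_after x0 h))). Qed.

Lemma oldest_first_age_optimal pi : (forall i j, p i = p j) ->
  (forall h a d, 0 < pi h a d -> oldest_first (ages_after x0 h) a d) ->
  age_optimal p x0 pi.
Proof.
move=> p_const old pi'; apply: limn_esup_le_mono => T.
rewrite lee_fin ler_wpM2l ?invr_ge0 // !expect_total_age ler_sum // => t _.
by rewrite optimal_age_eq_expect // optimal_age_le_expect.
Qed.

End OptimalAge.

Lemma user_index_lt (R : realType) (N : nat) (p : 'I_N -> R) (i j : 'I_N) (x y : nat) :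
  0 < p i -> p i = p j -> (x < y)%N ->
  user_index p i x true < user_index p j y true.
Proof.
rewrite /user_index => pi0 <- xy.
have x0 : 0 <= x%:R :> R by [].
have xy1 : x%:R + 1 <= y%:R :> R by rewrite natr1 ler_nat.
have : x%:R / p i < y%:R / p i by rewrite ltr_pM2r ?invr_gt0 // ltr_nat.
(* Strictness comes from the terms in [p i]; the rest is monotone because [(y - x) * (y + x - 1)] is
   nonnegative. *)
nra.
Qed.

Lemma index_algorithm_oldest_first (R : realType) (N : nat) (p : 'I_N -> R)
    (x0 : ages N) (pi : algorithm R N) :
  (forall i, 0 < p i) -> (forall i j, p i = p j) -> (forall i, 0 < x0 i)%N ->
  index_algorithm p x0 pi ->
  forall h a d, 0 < pi h a d -> oldest_first (ages_after x0 h) a d.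
Proof.
move=> p_gt0 p_const x0_gt0 idx h a d /idx[i -> max_i]; exists i => // j aj.
have := max_i j; rewrite aj; case: (a i) => /= [|le0].
  by apply: contraTT; rewrite -ltnNge -ltNge; exact: user_index_lt.
(* Without an arrival at [i] the maximal index would be 0. But the index of [j] exceeds the one at
   the fictitious age 0, which is 0, because ages are positive. *)
have := user_index_lt (p_gt0 j) erefl (ages_after_gt0 h j x0_gt0).
by rewrite ltNge [user_index _ _ 0 _]/user_index expr0n !mul0r subrr addr0 le0.
Qed.

Theorem lemma21 (R : realType) (N : nat) (p : 'I_N -> R) (x0 : ages N)
    (N_ge1 : (1 <= N)%N)
    (p_prob : forall i, 0 < p i <= 1)
    (x0_ge1 : forall i, (1 <= x0 i)%N)
    (x0_distinct : forall i j, i != j -> x0 i != x0 j)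
    (p_same : forall i j, i != j -> p i = p j)
    (pi : algorithm R N) :
  index_algorithm p x0 pi -> age_optimal p x0 pi.
Proof.
move=> idx.
have p_const i j : p i = p j by have [->|/p_same] := eqVneq i j.
have p_gt0 i : 0 < p i by have /andP[] := p_prob i.
apply: oldest_first_age_optimal => // [i|].
  by have /andP[_ ->] := p_prob i; rewrite ltW.
exact: index_algorithm_oldest_first.
Qed.
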